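(* Let $(M,\Sigma)$ be a half-translation Veech surface with marked points that is horizontally periodic and normalized, with Veech group $\Gamma$. Let $\mathrm{d}_1$ be the maximal distance in $\overline{\mathcal{G}}=\mathcal{G}/\Gamma$ from $v_\infty$ to another vertex in $\mathcal{V}$, where $\mathcal{V}$ is the set of vertices of $\overline{\mathcal{G}}$ representing $\Gamma$-orbits in $\mathcal{C}$ and $v_\infty\in\mathcal{V}$ represents the $\Gamma$-orbit of $\infty$. Then Algorithm A described in the context stops after $\mathrm{d}_1$ iterations (that is, $n=\mathrm{d}_1$ is the first index for which $\mathbf{C}^1_n=\varnothing$).
   Context: Surfaces. A half-translation surface $M$ is a compact connected Riemann surface with a nonzero meromorphic quadratic differential $q$ having at most simple poles, endowed with the flat metric of $q$ and assumed to have area $1$; $\Sigma\subset M$ is a finite non-empty subset containing all zeros and poles of $q$. A saddle connection is a geodesic segment with endpoints in $\Sigma$ and no point of $\Sigma$ in its interior; if its holonomy vector (period, measured on the orienting double cover where $q=\hat\omega^2$) is $\pm(a_x+\imath a_y)$, its slope is $a_x/a_y\in\mathbb{R}\cup\{\infty\}=\partial\mathbb{H}$ (horizontal has slope $\infty$). An embedded triangle is the image of a map $\varphi:\mathrm{T}\to M$, $\mathrm{T}\subset\mathbb{R}^2$ a triangle with vertex set $\mathrm{T}^{(0)}$, with $\varphi(\mathrm{T}^{(0)})\subset\Sigma$, $\varphi|_{\mathrm{T}\setminus\mathrm{T}^{(0)}}$ an embedding into $M\setminus\Sigma$, and $\varphi^*q=dz^2$. $\mathcal{I}(M,\Sigma)$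 is the set of hyperbolic ideal triangles whose vertices are the slopes of the three sides of an embedded triangle; $\mathcal{C}=\mathcal{C}(M,\Sigma)$ is the set of vertices of elements of $\mathcal{I}=\mathcal{I}(M,\Sigma)$. The Veech group $\Gamma\subset\mathrm{PSL}(2,\mathbb{R})$ is the group of derivatives $\pm A$, $A\in\mathrm{SL}(2,\mathbb{R})$, of the orientation-preserving homeomorphisms of $M$ preserving $\Sigma$ and of the form $v\mapsto\pm Av+c$ in flat charts of $M\setminus\Sigma$. $(M,\Sigma)$ is a Veech surface if $\Gamma$ is a lattice. $\Gamma$ acts by Möbius maps, preserving $\mathcal{C}$ and $\mathcal{I}$; two elements are equivalent if they are in the same $\Gamma$-orbit. The graph $\mathcal{G}$ has vertex set $\mathcal{C}\sqcup\mathcal{I}$, with an edge of length $1/2$ between $k\in\mathcal{C}$ and $\Delta\in\mathcal{I}$ iff $k$ is a vertex of $\Delta$, and no other edges; $\overline{\mathcal{G}}=\mathcal{G}/\Gamma$ carries the induced path metric (edges of length $1/2$). Reference domains. A horizontally periodic surface is normalized if its shortest horizontal saddle connection has length $1$. For $k\in\mathcal{C}$ choose $A\in\mathrm{PSL}(2,\mathbb{R})$ with $A(k)=\infty$ and $(M',\Sigma')=A\cdot(M,\Sigma)$ normalized ($A$ is determined up to left multiplication by matrices $\begin{pmatrix}1&t\\0&1\end{pmatrix}$, $t\in\mathbb{R}$). Let $\Gamma'=A\Gamma A^{-1}$ be the Veech group of $(M',\Sigma')$ and $a>0$ the real number such that the stabilizer of $\infty$ in $\Gamma'$ is $\{\pm\begin{pmatrix}1&na\\0&1\end{pmatrix}: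 n\in\mathbb{Z}\}$. Let $\mathcal{I}^*(M',\Sigma',\infty)$ be the set of $\Delta\in\mathcal{I}(M',\Sigma')$ having $\infty$ as a vertex and intersecting the vertical strip $(0,a)\times\mathbb{R}_+$. Put $\mathcal{I}^*(k)=A^{-1}(\mathcal{I}^*(M',\Sigma',\infty))\subset\mathcal{I}$; the union of its triangles is called a reference domain for $k$. Let $\mathbf{N}(k)$ be the set of $k'\in\mathcal{C}$, $k'\ne k$, that are vertices of some triangle in $\mathcal{I}^*(k)$. Algorithm A. Initialization: $\mathbf{C}^0_0=\{\infty\}$, and $\mathbf{C}^1_0$ is a subset of $\mathbf{N}(\infty)$ such that no element of $\mathbf{C}^1_0$ is equivalent to $\infty$, every element of $\mathbf{N}(\infty)$ is equivalent to $\infty$ or to an element of $\mathbf{C}^1_0$, and no two distinct elements of $\mathbf{C}^1_0$ are equivalent. Iteration: given $\mathbf{C}^0_n$ and $\mathbf{C}^1_n\neq\varnothing$, set $\hat{\mathbf{N}}_{n+1}=\bigcup_{k\in\mathbf{C}^1_n}\mathbf{N}(k)$ and pick $\hat{\mathbf{N}}'_{n+1}\subset\hat{\mathbf{N}}_{n+1}$ such that no element of $\hat{\mathbf{N}}'_{n+1}$ is equivalent to an element of $\mathbf{C}^0_n\sqcup\mathbf{C}^1_n$, and every element of $\hat{\mathbf{N}}_{n+1}$ is either equivalent to an element of $\mathbf{C}^0_n\sqcup\mathbf{C}^1_n$ or to a unique element of $\hat{\mathbf{N}}'_{n+1}$. Set $\mathbf{C}^0_{n+1}=\mathbf{C}^0_n\sqcup\mathbf{C}^1_n$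 and $\mathbf{C}^1_{n+1}=\hat{\mathbf{N}}'_{n+1}$. The algorithm stops when $\mathbf{C}^1_n=\varnothing$. *)

(* Defs.v *)
From HB Require Import structures.
From mathcomp Require Import all_boot all_order all_algebra complex.
From mathcomp Require Import all_classical all_reals all_analysis.

Set Implicit Arguments.
Unset Strict Implicit.
Unset Printing Implicit Defensive.

Import Order.TTheory GRing.Theory Num.Theory numFieldNormedType.Exports.
Local Open Scope classical_set_scope.
Local Open Scope ring_scope.
Local Open Scope complex_scope.

(* The copy [_^o] is the one that carries the topology and the normed module
   structure over itself; differentiability on it is complex
   differentiability. *)
Notation cplx R := ((complex R)^o).

(* The boundary of the hyperbolic plane; [None] is the point at infinity. *)
Notation boundary R := (option R).

Definition lebesgue2 {R : realType} :=
  (@lebesgue_measure R \x @lebesgue_measure R)%E.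

Definition slope {R : realType} (h : cplx R) : boundary R :=
  if complex.Im h == 0 then None else Some (complex.Re h / complex.Im h).

Definition direction {R : realType} (k : boundary R) : cplx R :=
  if k is Some x then x +i* 1 else 1 +i* 0.

Definition linact {R : realType} (A : 'M[R]_2) (z : cplx R) : cplx R :=
  (A 0 0 * complex.Re z + A 0 1 * complex.Im z) +i*
  (A 1 0 * complex.Re z + A 1 1 * complex.Im z).

(* Extension of the Moebius action to the boundary: slopes are homogeneous
   coordinates. *)
Definition mobius {R : realType} (A : 'M[R]_2) (k : boundary R) : boundary R :=
  slope (linact A (direction k)).

Definition upper_half_plane {R : realType} : set (cplx R) :=
  [set z | 0 < complex.Im z].

Definition mobiusH {R : realType} (A : 'M[R]_2) (z : cplx R) : cplx R :=
  ((A 0 0)%:C * z + (A 0 1)%:C) / ((A 1 0)%:C * z + (A 1 1)%:C).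

Definition unipotent {R : realType} (t : R) : 'M[R]_2 :=
  \matrix_(i, j) (if (i == 0) && (j == 1) then t else (i == j)%:R).

(* [param] is the inverse of [coord]; the values of [coord] off [dom] and of
   [param] off [coord @` dom] are irrelevant. *)
Record chart (R : realType) (M : topologicalType) := Chart {
  dom : set M;
  coord : M -> cplx R;
  param : cplx R -> M
}.

Definition is_chart {R : realType} {M : topologicalType} (c : chart R M) :=
  [/\ open (dom c), open (coord c @` dom c),
      (forall x, dom c x -> param c (coord c x) = x),
      {within dom c, continuous (coord c)} &
      {within coord c @` dom c, continuous (param c)}].

(* The change of coordinates from [c] to [c'] is holomorphic and carries
   [f' dz'^2] to [f dz^2]. *)
Definition pulls_back {R : realType} {M : topologicalType}
    (c : chart R M) (f : cplx R -> cplx R)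
    (c' : chart R M) (f' : cplx R -> cplx R) :=
  forall x, dom c x -> dom c' x ->
    exists2 d : cplx R,
      is_derive (coord c x) (1 : cplx R)
        (fun z : cplx R => coord c' (param c z)) d &
      f' (coord c' x) * d ^+ 2 = f (coord c x).

(* [f] has order [k] at [u].  Since [0 ^ k = 0] for every nonzero [k : int],
   the value of [f] at a pole is by convention 0; with it the transformation
   law of a quadratic differential holds at its poles as well. *)
Definition has_order {R : realType} (f : cplx R -> cplx R) (u : cplx R)
    (k : int) :=
  exists g : cplx R -> cplx R,
    [/\ (\forall w \near u, derivable g w (1 : cplx R)), g u != 0 &
        \forall w \near u, f w = (w - u) ^ k * g w].

Definition meromorphic_at {R : realType} (f : cplx R -> cplx R) (u : cplx R) :=
  (\forall w \near u, f w = 0) \/ exists k, has_order f u k.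

(* [mu] is the area measure of the metric |q|, on the Borel sets of [M].  A
   base point is needed to speak of the generated sigma-algebra. *)
Definition is_area_measure {R : realType} {M : ptopologicalType}
    (atlas : set (chart R M)) (qcoef : chart R M -> cplx R -> cplx R)
    (mu : {measure set (g_sigma_algebraType (@open M)) -> \bar R}) :=
  forall (c : chart R M) (B : set (g_sigma_algebraType (@open M))),
    atlas c -> measurable B -> B `<=` dom c ->
    mu B = (\int[lebesgue2]_(p in
              [set p : R * R | (coord c @` B) (p.1 +i* p.2)])
              (Normc.normc (qcoef c (p.1 +i* p.2)))%:E)%E.

(* A compact connected Riemann surface [M], given by an atlas, with a nonzero
   meromorphic quadratic differential with at most simple poles, equal to
   [qcoef c z dz^2] in the chart [c], and of area 1. *)
Record half_translation (R : realType) (M : ptopologicalType) :=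
  HalfTranslation {
  atlas : set (chart R M);
  qcoef : chart R M -> cplx R -> cplx R;
  ht_hausdorff : hausdorff_space M;
  ht_compact : compact [set: M];
  ht_connected : connected [set: M];
  ht_chart : forall c, atlas c -> is_chart c;
  ht_cover : forall x, exists2 c, atlas c & dom c x;
  ht_change : forall c c', atlas c -> atlas c' ->
    pulls_back c (qcoef c) c' (qcoef c');
  ht_meromorphic : forall c x, atlas c -> dom c x ->
    meromorphic_at (qcoef c) (coord c x);
  ht_nonzero : exists c x, [/\ atlas c, dom c x & qcoef c (coord c x) != 0];
  ht_simple_poles : forall c x k, atlas c -> dom c x ->
    has_order (qcoef c) (coord c x) k -> -1 <= k;
  ht_area : exists2 mu, is_area_measure atlas qcoef mu & mu [set: M] = 1%:E
}.

Definition zero_or_pole {R : realType} {M : ptopologicalType}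
    (S : half_translation R M) (x : M) :=
  exists c k, [/\ atlas S c, dom c x, k != 0 &
                  has_order (qcoef S c) (coord c x) k].

Definition marked_set {R : realType} {M : ptopologicalType}
    (S : half_translation R M) (Sigma : set M) :=
  [/\ finite_set Sigma, Sigma !=set0 & zero_or_pole S `<=` Sigma].

(* A chart of [M \ Sigma], compatible with the complex structure, in which
   [q = dz^2]. *)
Definition flat_chart {R : realType} {M : ptopologicalType}
    (S : half_translation R M) (Sigma : set M) (c : chart R M) :=
  [/\ is_chart c, dom c `<=` ~` Sigma &
      forall c', atlas S c' ->
        pulls_back c (fun=> 1) c' (qcoef S c') /\
        pulls_back c' (qcoef S c') c (fun=> 1)].

(* Near [t], [gam] moves with velocity [h] in some flat chart.  Flat charts
   are unique up to [z |-> +-z + b], so that [h] is defined up to sign. *)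
Definition straight_at {R : realType} {M : ptopologicalType}
    (S : half_translation R M) (Sigma : set M) (gam : R -> M) (h : cplx R)
    (t : R) :=
  exists (c : chart R M) (b : cplx R),
    [/\ flat_chart S Sigma c, dom c (gam t) &
        \forall s \near t,
          dom c (gam s) /\ coord c (gam s) = s%:C * h + b].

(* [gam], restricted to [0, 1], has holonomy [+-h].  Flat charts avoid [Sigma],
   hence so does the interior of the segment. *)
Definition saddle_connection {R : realType} {M : ptopologicalType}
    (S : half_translation R M) (Sigma : set M) (gam : R -> M) (h : cplx R) :=
  [/\ h != 0, {within `[0, 1], continuous gam}, Sigma (gam 0), Sigma (gam 1) &
      forall t : R, 0 < t < 1 -> straight_at S Sigma gam h t].

Definition closed_geodesic {R : realType} {M : ptopologicalType}
    (S : half_translation R M) (Sigma : set M) (gam : R -> M) (h : cplx R) :=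
  [/\ h != 0, (forall t : R, straight_at S Sigma gam h t) &
      exists2 L : R, 0 < L & forall t, gam (t + L) = gam t].

(* Every horizontal leaf of [M \ Sigma] is a closed geodesic or the interior of
   a saddle connection. *)
Definition horizontally_periodic {R : realType} {M : ptopologicalType}
    (S : half_translation R M) (Sigma : set M) :=
  forall p, ~ Sigma p -> exists (gam : R -> M) (h : cplx R),
    slope h = None /\
    ((closed_geodesic S Sigma gam h /\ exists t, gam t = p) \/
     (saddle_connection S Sigma gam h /\ exists2 t, 0 < t < 1 & gam t = p)).

Definition normalized {R : realType} {M : ptopologicalType}
    (S : half_translation R M) (Sigma : set M) :=
  (exists gam h, [/\ saddle_connection S Sigma gam h, slope h = None &
                     Normc.normc h = 1]) /\
  (forall gam h, saddle_connection S Sigma gam h -> slope h = None ->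
     1 <= Normc.normc h).

Definition triangle {R : realType} (v : 'I_3 -> cplx R) : set (cplx R) :=
  [set z | exists t : 'I_3 -> R,
     [/\ forall i, 0 <= t i, \sum_i t i = 1 &
         z = \sum_i (t i)%:C * v i]].

Definition nondegenerate {R : realType} (v : 'I_3 -> cplx R) :=
  let a := v 1 - v 0 in let b := v 2%:R - v 0 in
  complex.Re a * complex.Im b != complex.Im a * complex.Re b.

(* The fourth clause says that the inverse of the injection [phi] is
   continuous; the last one is [phi^* q = dz^2]. *)
Definition embedded_triangle {R : realType} {M : ptopologicalType}
    (S : half_translation R M) (Sigma : set M) (v : 'I_3 -> cplx R)
    (phi : cplx R -> M) :=
  let T := triangle v in let T' := T `\` range v in
  [/\ nondegenerate v,
      {within T, continuous phi} /\ (forall i, Sigma (phi (v i))),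
      {in T' &, injective phi} /\ phi @` T' `<=` ~` Sigma,
      (forall x (U : set (cplx R)), T' x -> nbhs x U ->
         exists2 V : set M, nbhs (phi x) V &
           forall y, T' y -> V (phi y) -> U y) &
      forall x, T' x -> exists (c : chart R M) (b : cplx R),
        [/\ flat_chart S Sigma c, dom c (phi x) &
            \forall y \near within T (nbhs x),
              dom c (phi y) /\ coord c (phi y) = y + b]].

(* An ideal triangle is encoded by the set of its three vertices, which
   determines it; [ideal_region] is the corresponding part of the hyperbolic
   plane. *)
Definition ideal_triangle {R : realType} (Delta : set (boundary R)) :=
  exists p q r, [/\ p != q, q != r, p != r & Delta = [set p; q; r]].

(* With directions [P1 + i P2] of [p] and [Q1 + i Q2] of [q], the real part of
   [(z P2 - P1) * conj (z Q2 - Q1)]; it vanishes on the geodesic from [p] to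
   [q] and has opposite signs on its two sides. *)
Definition geodesic_form {R : realType} (p q : boundary R) (z : cplx R) : R :=
  let P := direction p in let Q := direction q in
  let u := complex.Re z in let v := complex.Im z in
  (u * complex.Im P - complex.Re P) * (u * complex.Im Q - complex.Re Q)
  + v ^+ 2 * (complex.Im P * complex.Im Q).

(* The sign of the form of [p] and [q] at the ideal point [r], in homogeneous
   coordinates. *)
Definition geodesic_form_bd {R : realType} (p q r : boundary R) : R :=
  let P := direction p in let Q := direction q in let W := direction r in
  (complex.Re W * complex.Im P - complex.Im W * complex.Re P) *
  (complex.Re W * complex.Im Q - complex.Im W * complex.Re Q).

(* The points lying, for each side, on the same side as the opposite vertex. *)
Definition ideal_region {R : realType} (Delta : set (boundary R)) :
    set (cplx R) :=
  [set z | upper_half_plane z /\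
     forall p q r, Delta p -> Delta q -> Delta r ->
       p != q -> q != r -> p != r ->
       0 <= geodesic_form p q z * geodesic_form_bd p q r].

(* [phi^* q = dz^2], so the side joining [phi (v i)] to [phi (v j)] has holonomy
   [+-(v j - v i)]. *)
Definition side_slopes {R : realType} (v : 'I_3 -> cplx R) :
    set (boundary R) :=
  [set k | exists i j, i != j /\ k = slope (v j - v i)].

Definition triangles {R : realType} {M : ptopologicalType}
    (S : half_translation R M) (Sigma : set M) : set (set (boundary R)) :=
  [set Delta | ideal_triangle Delta /\
     exists v phi, embedded_triangle S Sigma v phi /\ Delta = side_slopes v].

Definition cusps {R : realType} {M : ptopologicalType}
    (S : half_translation R M) (Sigma : set M) : set (boundary R) :=
  [set k | exists2 Delta, triangles S Sigma Delta & Delta k].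

Definition homeomorphism {X Y : topologicalType} (f : X -> Y) :=
  exists g : Y -> X,
    [/\ cancel f g, cancel g f, continuous f & continuous g].

(* [f] has the form [v |-> +-A v + b] in flat charts of [M \ Sigma]; the sign
   is absorbed by the choice of the charts. *)
Definition affine {R : realType} {M : ptopologicalType}
    (S S' : half_translation R M) (Sigma : set M) (A : 'M[R]_2)
    (f : M -> M) :=
  forall p, ~ Sigma p -> exists (c c' : chart R M) (b : cplx R),
    [/\ flat_chart S Sigma c, flat_chart S' Sigma c', dom c p, dom c' (f p) &
        \forall x \near p, [/\ dom c x, dom c' (f x) &
                               coord c' (f x) = linact A (coord c x) + b]].

(* The preimage in SL(2,R) of the Veech group; it is stable under sign change.
   Maps with derivative of determinant 1 preserve the orientation. *)
Definition veech_group {R : realType} {M : ptopologicalType}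
    (S : half_translation R M) (Sigma : set M) : set 'M[R]_2 :=
  [set A | \det A = 1 /\
     exists f : M -> M,
       [/\ homeomorphism f, f @` Sigma = Sigma & affine S S Sigma A f]].

(* A discrete subgroup for which the quotient of the hyperbolic plane has
   finite area: [F] is a strict fundamental domain. *)
Definition lattice {R : realType} (G : set 'M[R]_2) :=
  (exists2 e : R, 0 < e &
     forall A, G A -> (forall i j, `|A i j - (i == j)%:R| < e) -> A = 1%:M) /\
  (exists F : set (R * R),
     [/\ measurable F,
         (forall p, F p -> upper_half_plane (p.1 +i* p.2)),
         (forall z : cplx R, upper_half_plane z ->
            exists! p, F p /\ exists2 A, G A & p.1 +i* p.2 = mobiusH A z) &
         (\int[lebesgue2]_(p in F) ((p.2 ^+ 2)^-1)%:E < +oo)%E]).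

Definition veech_surface {R : realType} {M : ptopologicalType}
    (S : half_translation R M) (Sigma : set M) :=
  marked_set S Sigma /\ lattice (veech_group S Sigma).

(* [S'] is [A . S]: the same topological surface, whose flat charts are those of
   [S] followed by [A]. *)
Definition is_image {R : realType} {M : ptopologicalType} (A : 'M[R]_2)
    (S S' : half_translation R M) (Sigma : set M) :=
  affine S S' Sigma A id.

Definition equivalent {R : realType} {M : ptopologicalType}
    (S : half_translation R M) (Sigma : set M) (k k' : boundary R) :=
  exists2 A, veech_group S Sigma A & k' = mobius A k.

Notation node R := (boundary R + set (boundary R))%type.

Definition nodes {R : realType} {M : ptopologicalType}
    (S : half_translation R M) (Sigma : set M) : set (node R) :=
  [set x | match x with
           | inl k => cusps S Sigma k
           | inr Delta => triangles S Sigma Delta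
           end].

Definition adjacent {R : realType} (x y : node R) : Prop :=
  match x, y with
  | inl k, inr Delta | inr Delta, inl k => Delta k
  | _, _ => False
  end.

Definition node_act {R : realType} (A : 'M[R]_2) (x : node R) : node R :=
  match x with
  | inl k => inl (mobius A k)
  | inr Delta => inr (mobius A @` Delta)
  end.

Definition node_orbit {R : realType} {M : ptopologicalType}
    (S : half_translation R M) (Sigma : set M) (x : node R) : set (node R) :=
  [set node_act A x | A in veech_group S Sigma].

Definition quotient_nodes {R : realType} {M : ptopologicalType}
    (S : half_translation R M) (Sigma : set M) : set (set (node R)) :=
  node_orbit S Sigma @` nodes S Sigma.

Definition quotient_adjacent {R : realType} {M : ptopologicalType}
    (S : half_translation R M) (Sigma : set M) (O P : set (node R)) :=
  exists x y, [/\ O x, P y, nodes S Sigma x, nodes S Sigma y & adjacent x y].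

Definition walk {R : realType} {M : ptopologicalType}
    (S : half_translation R M) (Sigma : set M) (O P : set (node R))
    (n : nat) :=
  exists w : nat -> set (node R),
    [/\ w 0%N = O, w n = P,
        (forall i, (i <= n)%N -> quotient_nodes S Sigma (w i)) &
        (forall i, (i < n)%N -> quotient_adjacent S Sigma (w i) (w i.+1))].

(* Edges have length 1/2. *)
Definition quotient_dist {R : realType} {M : ptopologicalType}
    (S : half_translation R M) (Sigma : set M) (O P : set (node R)) : \bar R :=
  ereal_inf [set (n%:R / 2)%:E | n in [set n | walk S Sigma O P n]].

Definition cusp_nodes {R : realType} {M : ptopologicalType}
    (S : half_translation R M) (Sigma : set M) : set (set (node R)) :=
  [set node_orbit S Sigma (inl k) | k in cusps S Sigma].

(* [d] is the maximal distance from the orbit of infinity to a point of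
   [cusp_nodes]; that orbit itself is included, so [d = 0] if there is no
   other. *)
Definition is_max_dist {R : realType} {M : ptopologicalType}
    (S : half_translation R M) (Sigma : set M) (d : R) :=
  let vinf := node_orbit S Sigma (inl None) in
  (exists2 v, cusp_nodes S Sigma v & quotient_dist S Sigma vinf v = d%:E) /\
  (forall v, cusp_nodes S Sigma v -> (quotient_dist S Sigma vinf v <= d%:E)%E).

Definition triangles_star {R : realType} {M : ptopologicalType}
    (S : half_translation R M) (Sigma : set M) (a : R) :
    set (set (boundary R)) :=
  [set Delta | [/\ triangles S Sigma Delta, Delta None &
     ideal_region Delta `&` [set z | 0 < complex.Re z < a] !=set0]].

(* [D] is the set of triangles of a reference domain for [k].  It depends on
   the choice of [A], which is only determined up to a horizontal shear. *)
Definition reference_domain {R : realType} {M : ptopologicalType}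
    (S : half_translation R M) (Sigma : set M) (k : boundary R)
    (D : set (set (boundary R))) :=
  exists (A : 'M[R]_2) (S' : half_translation R M) (a : R),
    [/\ \det A = 1 /\ mobius A k = None,
        is_image A S S' Sigma /\ normalized S' Sigma,
        0 < a,
        [set B | veech_group S' Sigma B /\ mobius B None = None] =
        [set B | exists n : int,
                   B = unipotent (n%:~R * a) \/ B = - unipotent (n%:~R * a)] &
        D = [set mobius (invmx A) @` Delta |
               Delta in triangles_star S' Sigma a]].

Definition neighbours {R : realType} {M : ptopologicalType}
    (S : half_translation R M) (Sigma : set M)
    (Istar : boundary R -> set (set (boundary R))) (k : boundary R) :
    set (boundary R) :=
  [set k' | [/\ cusps S Sigma k', k' != k &
                exists2 Delta, Istar k Delta & Delta k']].

Definition algorithm_init {R : realType} {M : ptopologicalType}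
    (S : half_translation R M) (Sigma : set M)
    (Istar : boundary R -> set (set (boundary R)))
    (C0 C1 : set (boundary R)) :=
  let N := neighbours S Sigma Istar None in
  let eqv := equivalent S Sigma in
  [/\ C0 = [set None], C1 `<=` N,
      (forall k, C1 k -> ~ eqv k None),
      (forall k, N k -> eqv k None \/ exists2 k', C1 k' & eqv k k') &
      (forall k k', C1 k -> C1 k' -> eqv k k' -> k = k')].

Definition algorithm_step {R : realType} {M : ptopologicalType}
    (S : half_translation R M) (Sigma : set M)
    (Istar : boundary R -> set (set (boundary R)))
    (C0 C1 C0' C1' : set (boundary R)) :=
  let Nhat := \bigcup_(k in C1) neighbours S Sigma Istar k in
  let eqv := equivalent S Sigma in
  [/\ C0' = C0 `|` C1, C1' `<=` Nhat,
      (forall k k', C1' k -> (C0 `|` C1) k' -> ~ eqv k k') &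
      (forall k, Nhat k ->
         (exists2 k', (C0 `|` C1) k' & eqv k k') \/
         (exists! k', C1' k' /\ eqv k k'))].

(* A run of the algorithm; nothing is required of the terms that follow the
   first empty [C1 n]. *)
Definition algorithm_run {R : realType} {M : ptopologicalType}
    (S : half_translation R M) (Sigma : set M)
    (Istar : boundary R -> set (set (boundary R)))
    (C0 C1 : nat -> set (boundary R)) :=
  algorithm_init S Sigma Istar (C0 0%N) (C1 0%N) /\
  forall n, (forall m, (m <= n)%N -> C1 m !=set0) ->
    algorithm_step S Sigma Istar (C0 n) (C1 n) (C0 n.+1) (C1 n.+1).

(* Main.v *)
Require Import Defs.
From mathcomp Require Import all_boot all_order all_algebra.
From mathcomp Require Import all_classical all_reals all_analysis.
From mathcomp Require Import complex ring lra.
Import Order.TTheory GRing.Theory Num.Theory.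
Import numFieldNormedType.Exports.
(* Below, [coord] is the coordinate of a chart and not that of a vector. *)
Import Defs.
Set Implicit Arguments.
Unset Strict Implicit.
Unset Printing Implicit Defensive.
Local Open Scope classical_set_scope.
Local Open Scope ring_scope.
Local Open Scope complex_scope.

(** Algorithm A is a breadth-first search of the cusps in the quotient graph, so
that its n-th layer consists of the orbits at distance n + 1 from the orbit of
infinity, and it stops at the first empty layer.

Two distinct cusps are at distance 1 in the graph when they are vertices of a
common triangle.  Write [cusp_ball n] for the cusps whose orbit can be reached
from the orbit of infinity through n triangles: these are the cusps at distance
at most n ([cusp_ball_dist], [dist_cusp_ball]).  By induction
([level_invariant]) [C0 n] and [C1 n] together represent all the orbits of
[cusp_ball n.+1], and the elements of [C1 n] lie outside [cusp_ball n].  If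
[C1 n] is empty then the balls stop growing ([cusp_ball_stationary]), which
happens precisely when n is the maximal distance.

The inductive step needs the set of neighbours taken from one reference domain
to contain, up to the Veech group, every cusp that shares a triangle with k
([triangle_neighbours]).  After normalization k is at infinity, a triangle with
vertex infinity lies over an interval of the real line, and a multiple of the
generating translation of the stabilizer moves it over the strip of the
reference domain ([translate_meets_strip], [reference_domain_covers]).

All this uses that the Veech group is a group acting on the triangles, and that
normalizing by a matrix carries triangles to triangles.  Both follow from one
statement on affine maps between two half-translation structures
([triangles_mobius]).  Affine maps are only given in some flat charts around
each point, so they can be composed because two flat charts differ by a map
[z |-> +-z + b] ([flat_transition]).  The change of charts is holomorphic with
derivative of square 1; [unit_derivative_affine] shows that it is affine by the
mean value theorem alone. *)

(** * Derivatives along real lines *)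

Lemma is_derive1_chain (K : numFieldType) (f g : K^o -> K^o) (x df dg : K^o) :
  is_derive x (1 : K^o) f df -> is_derive (f x) (1 : K^o) g dg ->
  is_derive x (1 : K^o) (g \o f) (dg * df).
Proof.
move=> Df Dg.
have /derivable1_diffP df1 := @ex_derive _ _ _ _ _ _ _ Df.
have /derivable1_diffP dg1 := @ex_derive _ _ _ _ _ _ _ Dg.
have dgf : differentiable (g \o f) x by exact: differentiable_comp.
apply: DeriveDef; first exact/derivable1_diffP.
rewrite deriveE// diff_comp //= -(deriveE _ df1) derive_val.
rewrite -[X in 'd g _ X]mulr1 [LHS]linearZ/= -deriveE// derive_val.
by rewrite mulrC.
Qed.


Lemma ReD (R : realType) (z w : cplx R) :
  complex.Re (z + w) = complex.Re z + complex.Re w.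
Proof. by case: z w => [a b] []. Qed.

Lemma ImD (R : realType) (z w : cplx R) :
  complex.Im (z + w) = complex.Im z + complex.Im w.
Proof. by case: z w => [a b] []. Qed.

Lemma ReN (R : realType) (z : cplx R) : complex.Re (- z) = - complex.Re z.
Proof. by case: z. Qed.

Lemma ImN (R : realType) (z : cplx R) : complex.Im (- z) = - complex.Im z.
Proof. by case: z. Qed.

Lemma ReMr (R : realType) (a : R) (z : cplx R) :
  complex.Re (a%:C * z) = a * complex.Re z.
Proof. by case: z => [x y] /=; rewrite mul0r subr0. Qed.

Lemma Re_continuous (R : realType) :
  continuous (fun z : cplx R => complex.Re z : R^o).
Proof.
move=> z; apply/(@cvgrPdist_lt R R^o _ _ (nbhs_filter (z : cplx R))) => e e0.
have e0' : 0 < e%:C :> R[i] by rewrite ltcR.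
have := @nbhsx_ballx _ (cplx R) z _ e0'.
apply: filterS => w; rewrite -ball_normE /= => zw.
rewrite -ltcR -ReN -ReD.
apply: le_lt_trans zw; exact: normc_ge_Re.
Qed.


Lemma real_complex_continuous (R : realType) :
  continuous (fun t : R^o => t%:C : cplx R).
Proof.
move=> t; apply/(@cvgrPdist_lt _ (cplx R) _ _ (nbhs_filter (t : R^o))) => e e0.
have eE : e = (complex.Re e)%:C by rewrite RRe_real// gtr0_real.
have e0' : 0 < complex.Re e by rewrite -ltcR -eE.
have := @nbhsx_ballx _ R^o t _ e0'.
apply: filterS => s; rewrite -ball_normE /= => ts.
rewrite eE normc_def /= ltcR [(- 0)%R]oppr0 addr0 expr0n addr0 sqrtr_sqr.
exact: ts.
Qed.

Lemma cmul_continuous (R : realType) (w : cplx R) :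
  continuous (fun z : cplx R => w * z : cplx R).
Proof. by move=> z; exact: (@scaler_continuous (complex R) (cplx R) w z). Qed.

(** A complex derivative along the direction [h] restricts to a real derivative; the
factor [w] selects which real linear form of the value is followed. *)
Lemma is_derive_Re_line (R : realType) (g : cplx R -> cplx R) (u h w d : cplx R)
    (t : R) : h != 0 ->
  is_derive (u + t%:C * h) (1 : cplx R) g d ->
  is_derive (t : R^o) (1 : R^o)
    (fun s : R^o => complex.Re (w * g (u + s%:C * h)) : R^o)
    (complex.Re (w * h * d)).
Proof.
move=> h0 [Dg dE].
set z0 := u + t%:C * h.
have lim : (fun s : R^o => s^-1 *: (complex.Re (w * g (u + (s *: 1 + t)%:C * h))
    - complex.Re (w * g z0)) : R^o) @ 0^' --> (complex.Re (w * h * d) : R^o).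
  have dlim : (fun k : cplx R => k^-1 *: (g (k *: 1 + z0) - g z0)) @ 0^' --> d.
    by rewrite -dE; exact: Dg.
  have hlim : (fun s : R^o => s%:C * h : cplx R) @ 0^' --> (0 : cplx R)^'.
    have hcont : {for 0, continuous (fun s : R^o => h * s%:C : cplx R)}.
      apply: (@continuous_comp _ _ _ (fun s : R^o => s%:C : cplx R)
                (fun z : cplx R => h * z)).
        exact: (@real_complex_continuous R _).
      exact: (@cmul_continuous R _ _).
    move=> B B0.
    have : nbhs (h * 0%:C : cplx R) (fun k => k != 0 -> B k) by rewrite mulr0.
    move=> /hcont; apply: (filterS (F := nbhs (0 : R^o))) => s Bs s0.
    rewrite /= mulrC; apply: Bs.
    by rewrite mulf_neq0// (inj_eq (@complexI R)).
  have wlim : (fun s : R^o => complex.Re ((w * h) *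
      ((s%:C * h)^-1 *: (g ((s%:C * h) *: 1 + z0) - g z0)))%R) @ 0^' -->
      (complex.Re (w * h * d) : R^o).
    have clim : continuous (fun z : cplx R => complex.Re (w * h * z) : R^o).
      move=> z; apply: (@continuous_comp _ _ _ ( *%R (w * h) : cplx R -> cplx R)).
        exact: (@cmul_continuous R _ _).
      exact: (@Re_continuous R _).
    have := cvg_comp _ _ (cvg_comp _ _ hlim dlim) (clim d).
    exact.
  apply: cvg_trans wlim; apply: near_eq_cvg; near=> s.
  have s0 : s != 0 by near: s; exact: nbhs_dnbhs_neq.
  have -> : (s%:C * h) *: 1 + z0 = u + (s *: 1 + t)%:C * h.
    rewrite /z0 [(s%:C * h) *: 1]mulr1 [s *: 1]mulr1 rmorphD mulrDl.
    by rewrite addrCA.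
  have -> : w * h * ((s%:C * h)^-1 *: (g (u + (s *: 1 + t)%:C * h) - g z0)) =
      (s^-1)%:C * (w * g (u + (s *: 1 + t)%:C * h) - w * g z0).
    have sC : s%:C != 0 :> R[i] by rewrite (inj_eq (@complexI R)).
    rewrite fmorphV -mulrBr; set X := (g _ - g _).
    rewrite -[_ *: X]/(_ * X).
    by field; apply/andP.
  by rewrite ReMr ReD ReN.
apply: DeriveDef.
  by apply/cvg_ex; eexists; exact: lim.
exact: cvg_lim lim.
Unshelve. all: by end_near.
Qed.

(** * Holomorphic functions with derivative plus or minus one *)

(** The real and imaginary parts of [(g (u + t h) - g u) / h] have derivatives
[+-1] and [0] in [t], at every [t]; the mean value theorem gives the increment
for [t = 1]. *)
Lemma unit_derivative_increment (R : realType) (g : cplx R -> cplx R)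
    (u h : cplx R) :
  (forall t : R, 0 <= t <= 1 -> exists2 d : cplx R,
     is_derive (u + t%:C * h) (1 : cplx R) g d & d ^+ 2 = 1) ->
  g (u + h) - g u = h \/ g (u + h) - g u = - h.
Proof.
move=> Dg; have [->|h0] := eqVneq h 0; first by left; rewrite addr0 subrr.
pose P t (d : cplx R) := 0 <= t <= 1 ->
  is_derive (u + t%:C * h) (1 : cplx R) g d /\ (d = 1 \/ d = -1).
have /choice[d dP] : forall t, exists d, P t d.
  move=> t; have [t01|t01] := pselect (0 <= t <= 1); last by exists 0.
  have [dt Dt /eqP] := Dg t t01.
  by rewrite sqrf_eq1 => dt1; exists dt; split => //; case/orP: dt1 => /eqP; auto.
have incr w : exists2 t : R, 0 <= t <= 1 &
    complex.Re (w * (g (u + h) - g u)) = complex.Re (w * h * d t).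
  pose G (s : R) : R := complex.Re (w * g (u + s%:C * h)).
  have DG t : 0 <= t <= 1 ->
      is_derive (t : R^o) (1 : R^o) (G : R^o -> R^o) (complex.Re (w * h * d t)).
    by move=> t01; apply: is_derive_Re_line => //; case: (dP t t01).
  have [] := @MVT R G (fun t => complex.Re (w * h * d t)) 0 1.
  - exact: ltr01.
  - by move=> x /[!in_itv]/= /andP[x0 x1]; apply: DG; rewrite !ltW.
  - apply: derivable_within_continuous => x /[!in_itv]/= x01.
    exact: (@ex_derive _ _ _ _ _ _ _ (DG x x01)).
  move=> c /[!in_itv]/= /andP[c0 c1] Gc; exists c; first by rewrite !ltW.
  move: Gc; rewrite subr0 mulr1 /G mul1r mul0r addr0 => <-.
  by rewrite mulrBr ReD ReN.
set k := h^-1 * (g (u + h) - g u).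
have Rek : complex.Re k = 1 \/ complex.Re k = -1.
  have [t t01 kE] := incr h^-1.
  rewrite /k kE mulVf // mul1r.
  by have [_ [->|->]] := dP t t01; auto.
have Imk : complex.Im k = 0.
  (* Multiplying by [- i] turns imaginary parts into real parts. *)
  have [t t01] := incr ((0 +i* -1) * h^-1).
  rewrite divfK// -mulrA -/k.
  have ImE z : complex.Re ((0 +i* -1) * z : cplx R) = complex.Im z.
    by case: z => [x y] /=; ring.
  by rewrite !ImE; have [_ [->|->] ->] := dP t t01; rewrite /= ?oppr0.
have -> : g (u + h) - g u = h * k by rewrite /k mulVKf.
case: k Rek Imk => [x y] /= xE ->; case: xE => ->; [left|right].
  by rewrite -[1 +i* 0]/(1 : R[i]) mulr1.
have -> : -1 +i* 0 = -1 :> R[i] by apply/eqP; rewrite eq_complex /= oppr0 !eqxx.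
by rewrite mulrN1.
Qed.

Lemma norm_real_complex (R : realType) (t : R) : `|t%:C : R[i]| = `|t|%:C.
Proof. by rewrite normc_def /= expr0n addr0 sqrtr_sqr. Qed.

(** By [unit_derivative_increment], on a disc all differences [g z' - g z] are
[+-(z' - z)].  Signs [+] at [z] and [-] at [z1] relative to [u] would give
[g z - g z1 = (z - u) + (z1 - u)], which is not [+-(z - z1)]. *)
Lemma unit_derivative_affine (R : realType) (g : cplx R -> cplx R)
    (u : cplx R) :
  (\forall z \near u, exists2 d : cplx R,
     is_derive z (1 : cplx R) g d & d ^+ 2 = 1) ->
  exists e b : cplx R, (e = 1 \/ e = -1) /\ \forall z \near u, g z = e * z + b.
Proof.
move=> /nbhs_ballP[r /= r0 Dg].
have incr z z' : ball u r z -> ball u r z' ->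
    g z' - g z = z' - z \/ g z' - g z = - (z' - z).
  rewrite -ball_normE /= => uz uz'.
  have seg t : 0 <= t <= 1 -> exists2 d : cplx R,
      is_derive (z + t%:C * (z' - z)) (1 : cplx R) g d & d ^+ 2 = 1.
    move=> /andP[t0 t1]; apply: Dg; rewrite -ball_normE /=.
    have -> : u - (z + t%:C * (z' - z)) = (1 - t)%:C * (u - z) + t%:C * (u - z').
      by rewrite rmorphB rmorph1; ring.
    apply: le_lt_trans (ler_normD _ _) _; rewrite !normrM !norm_real_complex.
    rewrite (ger0_norm t0) (@ger0_norm _ (1 - t)) ?subr_ge0//.
    have -> : r = (1 - t)%:C * r + t%:C * r by rewrite rmorphB rmorph1; ring.
    have [->|tn0] := eqVneq t 0.
      by rewrite subr0 rmorph1 rmorph0 !mul0r !addr0 !mul1r.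
    apply: ler_ltD; first by rewrite ler_wpM2l ?ler0c ?subr_ge0 // ltW.
    by rewrite ltr_pM2l // ltcR lt_neqAle eq_sym tn0.
  have := @unit_derivative_increment R g z (z' - z) seg.
  by rewrite [z + _]addrC subrK.
have uu : ball u r u by exact: ballxx.
have [all1|] := pselect (forall z, ball u r z -> g z - g u = z - u).
  exists 1, (g u - u); split; first by left.
  apply/nbhs_ballP; exists r => //= z uz.
  by rewrite mul1r addrCA -(all1 z uz) addrC subrK.
move=> /existsNP[z1 /not_implyP[uz1 gz1]].
exists (-1), (g u + u); split; first by right.
apply/nbhs_ballP; exists r => //= z uz.
suff E : g z - g u = - (z - u) by rewrite -[LHS](subrK (g u)) E; ring.
have [gz|//] := incr _ _ uu uz.
have [//|gz1'] := incr _ _ uu uz1.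
have gzz1 : g z - g z1 = (z - u) + (z1 - u).
  by rewrite -gz -[z1 - u]opprK -gz1'; ring.
have [|] := incr _ _ uz1 uz; rewrite gzz1 => E.
  have z1u : z1 - u = 0.
    apply: (mulIf (x := 2)); first by rewrite pnatr_eq0.
    rewrite mul0r mulr_natr mulr2n.
    by rewrite -[RHS](subrr (z - z1)) -[X in _ = X - _]E; ring.
  by case: gz1; rewrite gz1' z1u oppr0.
have zu : z - u = 0.
  apply: (mulIf (x := 2)); first by rewrite pnatr_eq0.
  rewrite mul0r mulr_natr mulr2n.
  by rewrite -[RHS](addNr (z - z1)) -[X in _ = X + _]E; ring.
by rewrite gz zu oppr0.
Qed.

(** * Flat charts and their transitions *)

Lemma nbhsS (T : topologicalType) (x : T) (A B : set T) :
  A `<=` B -> nbhs x A -> nbhs x B.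
Proof. exact: filterS. Qed.

Lemma nbhsS2 (T : topologicalType) (x : T) (A B C : set T) :
  (forall y, A y -> B y -> C y) -> nbhs x A -> nbhs x B -> nbhs x C.
Proof. exact: filterS2. Qed.

Lemma nbhsI (T : topologicalType) (x : T) (A B : set T) :
  nbhs x A -> nbhs x B -> nbhs x (A `&` B).
Proof. exact: filterI. Qed.

Lemma Im_continuous (R : realType) :
  continuous (fun z : cplx R => complex.Im z : R^o).
Proof.
have -> : (fun z : cplx R => complex.Im z) =
    (fun z : cplx R => complex.Re z) \o (fun z => (0 +i* -1) * z : cplx R).
  by apply/funext => -[x y] /=; ring.
move=> z; apply: continuous_comp; first exact: (@cmul_continuous R _ _).
exact: (@Re_continuous R _).
Qed.

(** A real linear map of the plane is a combination of the real and imaginary parts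
with complex coefficients, its two columns. *)
Lemma linact_continuous (R : realType) (A : 'M[R]_2) :
  continuous (linact A : cplx R -> cplx R).
Proof.
have -> : linact A = (fun z => (A 0 0 +i* A 1 0) * (complex.Re z)%:C +
    (A 0 1 +i* A 1 1) * (complex.Im z)%:C : cplx R).
  by apply/funext => -[x y]; apply/eqP; rewrite eq_complex /=; apply/andP; split;
    apply/eqP; ring.
move=> z; apply: (@continuousD _ (cplx R)).
  apply: (@continuous_comp _ _ _ (fun z : cplx R => (complex.Re z)%:C : cplx R));
    last exact: (@cmul_continuous R _ _).
  apply: (@continuous_comp _ _ _ (fun z : cplx R => complex.Re z : R^o));
    [exact: (@Re_continuous R _)|exact: (@real_complex_continuous R _)].
apply: (@continuous_comp _ _ _ (fun z : cplx R => (complex.Im z)%:C : cplx R));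
  last exact: (@cmul_continuous R _ _).
apply: (@continuous_comp _ _ _ (fun z : cplx R => complex.Im z : R^o));
  [exact: (@Im_continuous R _)|exact: (@real_complex_continuous R _)].
Qed.

Lemma linactD (R : realType) (A : 'M[R]_2) (z w : cplx R) :
  linact A (z + w) = linact A z + linact A w.
Proof.
by rewrite /linact !ReD !ImD; apply/eqP; rewrite eq_complex /=;
  apply/andP; split; apply/eqP; ring.
Qed.

Lemma linactZ (R : realType) (A : 'M[R]_2) (t : R) (z : cplx R) :
  linact A (t%:C * z) = t%:C * linact A z.
Proof.
by case: z => x y; rewrite /linact /=; apply/eqP; rewrite eq_complex /=;
  apply/andP; split; apply/eqP; ring.
Qed.

Lemma linactN (R : realType) (A : 'M[R]_2) (z : cplx R) :
  linact A (- z) = - linact A z.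
Proof.
by rewrite /linact !ReN !ImN; apply/eqP; rewrite eq_complex /=;
  apply/andP; split; apply/eqP; ring.
Qed.

Lemma linactM (R : realType) (A B : 'M[R]_2) (z : cplx R) :
  linact (A *m B) z = linact A (linact B z).
Proof.
rewrite /linact !mxE !big_ord_recl !big_ord0 /=.
have -> : lift ord0 ord0 = 1 :> 'I_2 by apply/val_inj.
by apply/eqP; rewrite eq_complex /=; apply/andP; split; apply/eqP; ring.
Qed.

Lemma linact1 (R : realType) (z : cplx R) : linact 1%:M z = z.
Proof.
by case: z => x y; rewrite /linact !mxE /=; apply/eqP; rewrite eq_complex /=;
  apply/andP; split; apply/eqP; ring.
Qed.

Lemma within_open_continuousP (X Y : topologicalType) (D : set X) (f : X -> Y) :
  open D -> {within D, continuous f} <-> forall x, D x -> {for x, continuous f}.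
Proof.
move=> oD; rewrite continuous_open_subspace//; split=> fc x.
  by move=> Dx; apply: fc; rewrite inE.
by rewrite inE => Dx; exact: fc.
Qed.

Section Charts.
Context {R : realType} {M : ptopologicalType}.
Implicit Types (c : chart R M) (S : half_translation R M) (Sigma : set M).

Lemma chart_nbhs c x : is_chart c -> dom c x -> nbhs x (dom c).
Proof. by case=> od _ _ _ _ dx; apply: open_nbhs_nbhs. Qed.

Lemma chart_coord_continuous c x :
  is_chart c -> dom c x -> {for x, continuous (coord c)}.
Proof. by case=> od _ _ /(within_open_continuousP _ od) + _; apply. Qed.

Lemma chart_param_continuous c z : is_chart c -> (coord c @` dom c) z ->
  {for z, continuous (param c : cplx R -> M)}.
Proof. by case=> _ oc _ _ /(within_open_continuousP _ oc); apply. Qed.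

Lemma chart_paramP c z : is_chart c -> (coord c @` dom c) z ->
  dom c (param c z) /\ coord c (param c z) = z.
Proof. by case=> _ _ cK _ _ [x dx <-]; rewrite cK. Qed.

(** A chart followed by multiplication by [e]; flatness is preserved when [e] is a sign.
The same [e] serves for [param] as [e] is then its own inverse. *)
Definition sign_chart (e : cplx R) c : chart R M :=
  Chart (dom c) (fun x => e * coord c x) (fun z => param c (e * z)).

Lemma sign_chart_is_chart (e : cplx R) c :
  e * e = 1 -> is_chart c -> is_chart (sign_chart e c).
Proof.
move=> ee ch; have [od oc cK cc pc] := ch.
have imE : coord (sign_chart e c) @` dom c =
    (fun z : cplx R => e * z) @^-1` (coord c @` dom c).
  apply/seteqP; split=> [_ [x dx <-]|z [x dx /= xz]]; exists x => //=.
    by rewrite mulrA ee mul1r.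
  by rewrite xz mulrA ee mul1r.
have oi : open (coord (sign_chart e c) @` dom c).
  rewrite imE; apply: open_comp => // z _; exact: (@cmul_continuous R _ _).
split=> //=.
- by move=> x dx; rewrite mulrA ee mul1r cK.
- apply/within_open_continuousP => // x dx.
  apply: continuous_comp; first exact: chart_coord_continuous.
  exact: (@cmul_continuous R _ _).
- apply/within_open_continuousP => // z.
  rewrite -/(coord (sign_chart e c)) imE => iz.
  apply: continuous_comp; first exact: (@cmul_continuous R _ _).
  exact: chart_param_continuous.
Qed.

Lemma is_derive_mull (e z : cplx R) :
  is_derive z (1 : cplx R) (fun w : cplx R => e * w : cplx R) e.
Proof.
have -> : (fun w : cplx R => e * w) = (e : complex R) \*: (id : cplx R -> cplx R).
  by apply/funext.
apply: is_derive_eq; exact: mulr1.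
Qed.

Lemma flat_chart_sign S Sigma (e : cplx R) c :
  e * e = 1 -> flat_chart S Sigma c -> flat_chart S Sigma (sign_chart e c).
Proof.
move=> ee [ch dS flat]; split=> //; first exact: sign_chart_is_chart.
move=> c' ac'; have [cc' c'c] := flat c' ac'; split=> x.
- move=> dx d'x; have [d Dd dE] := cc' x dx d'x.
  exists (d * e); last by rewrite exprMn [e ^+ 2]ee mulr1.
  apply: (@is_derive1_chain (complex R) (fun z => e * z)
            (fun z => coord c' (param c z))) => /=.
    exact: is_derive_mull.
  by rewrite mulrA ee mul1r.
- move=> d'x dx; have [d Dd dE] := c'c x d'x dx.
  exists (e * d); last by rewrite exprMn [e ^+ 2]ee mul1r.
  apply: (@is_derive1_chain (complex R) (fun z => coord c (param c' z))
            (fun z => e * z)) => //=.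
  exact: is_derive_mull.
Qed.

(** Pass through a chart of the atlas: the two factors of the derivative of the
change of charts have squares [1 / q] and [q], so that its square is 1. *)
Lemma flat_transition S Sigma c c' p :
  flat_chart S Sigma c -> flat_chart S Sigma c' -> dom c p -> dom c' p ->
  exists e b : cplx R, (e = 1 \/ e = -1) /\
    \forall x \near p, coord c' x = e * coord c x + b.
Proof.
move=> [ch _ flat] [ch' _ flat'] dp dp'.
have [a aa ap] := ht_cover S p.
have cha := ht_chart aa.
have [ca _] := flat a aa; have [_ ac'] := flat' a aa.
have [od oc cK _ _] := ch.
(* On [V] both changes of charts, to [a] and to [c'], are defined. *)
pose V := [set z | [/\ (coord c @` dom c) z, dom a (param c z) &
                       dom c' (param c z)]].
have imp : (coord c @` dom c) (coord c p) by exists p.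
have nV : nbhs (coord c p) V.
  have pcont := chart_param_continuous ch imp.
  have nd (D : set M) : nbhs p D -> nbhs (coord c p) (param c @^-1` D).
    by move=> nD; apply: pcont; rewrite cK.
  have := nbhsI (open_nbhs_nbhs (conj oc imp))
    (nbhsI (nd _ (chart_nbhs cha ap)) (nd _ (chart_nbhs ch' dp'))).
  by apply: nbhsS => z [? []].
have [|e [b [e1 geq]]] := @unit_derivative_affine R
    (fun z => coord c' (param c z)) (coord c p).
  apply: (nbhsS _ (nbhs_interior nV)) => z nVz.
  have [iz daz dcz] := nbhs_singleton nVz.
  have [dz cz] := chart_paramP ch iz.
  have [d Dd dE] := ca _ dz daz.
  have [d' Dd' d'E] := ac' _ daz dcz.
  exists (d' * d); last by rewrite exprMn -[d' ^+ 2]mul1r d'E dE.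
  rewrite cz in Dd.
  have Dcomp := @is_derive1_chain (complex R) (fun z => coord a (param c z))
            (fun z => coord c' (param a z)) z d d' Dd Dd'.
  apply: near_eq_is_derive Dcomp.
  apply: nbhsS nVz => w [_ daw _] /=.
  by have [_ _ aK _ _] := cha; rewrite aK.
exists e, b; split => //.
have := chart_coord_continuous ch dp geq.
have := chart_nbhs ch dp; apply: nbhsS2 => x dx /=.
by rewrite cK.
Qed.

End Charts.

(** * Affine maps between half-translation surfaces *)

Section AffineMaps.
Context {R : realType} {M : ptopologicalType}.
Implicit Types (c : chart R M) (S : half_translation R M) (Sigma : set M).
Implicit Types (A B : 'M[R]_2).

(** For [S = S'] this is the Veech group, and for [f = id] it relates a surface to its
image under a matrix; in this common form
the two can be composed. *)
Definition affinely_equivalent S S' Sigma A :=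
  \det A = 1 /\ exists f : M -> M,
    [/\ homeomorphism f, f @` Sigma = Sigma & affine S S' Sigma A f].

Lemma unmarked_image Sigma (f : M -> M) p :
  homeomorphism f -> f @` Sigma = Sigma -> ~ Sigma p -> ~ Sigma (f p).
Proof.
move=> [g [fK _ _ _]] fS np; rewrite -fS => -[x Sx fxp]; apply: np.
by rewrite -[p]fK -fxp fK.
Qed.

Lemma linact_sign A (e z : cplx R) :
  e = 1 \/ e = -1 -> linact A (e * z) = e * linact A z.
Proof. by move=> [->|->]; rewrite ?mul1r// !mulN1r linactN. Qed.

Lemma sign_sqr (e : cplx R) : e = 1 \/ e = -1 -> e * e = 1.
Proof. by move=> [->|->]; rewrite ?mulrNN mulr1. Qed.

(** The flat chart of the source can be prescribed, since another choice changes the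
coordinates by a sign and a constant, and the sign can be moved to the target. *)
Lemma affine_in_chart S S' Sigma A (f : M -> M) c p :
  affine S S' Sigma A f -> ~ Sigma p -> flat_chart S Sigma c -> dom c p ->
  exists (c' : chart R M) (b : cplx R),
    [/\ flat_chart S' Sigma c', dom c' (f p) &
        \forall x \near p, [/\ dom c x, dom c' (f x) &
                               coord c' (f x) = linact A (coord c x) + b]].
Proof.
move=> fA np fc dp; have [c1 [c2 [b [f1 f2 d1 d2 E]]]] := fA p np.
have [e [b1 [e1 T]]] := flat_transition fc f1 dp d1.
have ee := sign_sqr e1.
exists (sign_chart e c2), (e * (linact A b1 + b)).
split => //; first exact: flat_chart_sign.
have [ch _ _] := fc.
apply: nbhsS2 (nbhsI (chart_nbhs ch dp) T) E => x [dx cx] [_ d2x /= ->].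
split=> //; rewrite cx linactD (linact_sign _ _ e1) -addrA mulrDr.
by rewrite mulrA ee mul1r.
Qed.

Lemma affinely_equivalent_comp S S' S'' Sigma A B :
  affinely_equivalent S S' Sigma A -> affinely_equivalent S' S'' Sigma B ->
  affinely_equivalent S S'' Sigma (B *m A).
Proof.
move=> [dA [f [hf fS fA]]] [dB [g [hg gS gB]]].
split; first by rewrite det_mulmx dA dB mulr1.
exists (g \o f); split.
- case: hf hg => f' [fK f'K fc f'c] [g' [gK g'K gc g'c]].
  exists (f' \o g'); split.
  + by move=> x /=; rewrite gK fK.
  + by move=> x /=; rewrite f'K g'K.
  + by move=> x; apply: continuous_comp; [exact: fc|exact: gc].
  + by move=> x; apply: continuous_comp; [exact: g'c|exact: f'c].
- by rewrite -image_comp fS gS.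
move=> p np; have [c1 [c2 [b [f1 f2 d1 d2 E]]]] := fA p np.
have nfp := unmarked_image hf fS np.
have [c3 [b' [f3 d3 E']]] := affine_in_chart gB nfp f2 d2.
exists c1, c3, (linact B b + b'); split=> //.
case: hf => _ [_ _ fc _]; apply: nbhsS2 E (fc p _ E') => x [d1x _ E1] [_ d3x E3].
by split=> //; rewrite [LHS]E3 E1 linactD linactM addrA.
Qed.

Lemma affinely_equivalent_inv S S' Sigma A :
  affinely_equivalent S S' Sigma A ->
  affinely_equivalent S' S Sigma (invmx A).
Proof.
move=> [dA [f [[g [fK gK fc gc]] fS fA]]].
have uA : A \in unitmx by rewrite unitmxE dA unitr1.
split; first by rewrite det_inv dA invr1.
have gS : g @` Sigma = Sigma.
  rewrite -{1}fS image_comp; apply/seteqP; split=> [_ [x Sx <-] /=|x Sx].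
    by rewrite fK.
  by exists x => //=; rewrite fK.
exists g; split=> //; first by exists f.
move=> p np.
have hg : homeomorphism g by exists f.
have ngp := unmarked_image hg gS np.
have [c [c' [b [fc1 fc2 d1 d2 E]]]] := fA _ ngp.
exists c', c, (- linact (invmx A) b); rewrite gK in d2; split=> //.
apply: nbhsS (gc p _ E) => x; rewrite /= gK => -[dx d'x ->]; split => //.
by rewrite linactD -linactM mulVmx// linact1 addrK.
Qed.

Lemma affinely_equivalent_image S S' Sigma A :
  \det A = 1 -> is_image A S S' Sigma -> affinely_equivalent S S' Sigma A.
Proof.
move=> dA Sim; split=> //; exists id; split => //; last by rewrite image_id.
by exists id; split => // x; exact: cvg_id.
Qed.

End AffineMaps.

(** * The Moebius action on slopes *)

Section Mobius.
Context {R : realType}.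
Implicit Types (A B : 'M[R]_2) (k : boundary R) (z : cplx R).

Lemma slopeZ (t : R) z : t != 0 -> slope (t%:C * z) = slope z.
Proof.
case: z => x y t0; rewrite /slope /= !mul0r subr0 addr0 mulf_eq0 (negPf t0) /=.
by case: eqP => // /eqP y0; congr Some; rewrite -mulf_div divff// mul1r.
Qed.

Lemma slope_direction k : slope (direction k) = k.
Proof.
by case: k => [x|]; rewrite /slope /= ?oner_eq0 ?eqxx// divr1.
Qed.

Lemma direction_neq0 k : direction k != 0.
Proof. by case: k => [x|]; rewrite eq_complex /= oner_eq0 ?andbF. Qed.

(** Slopes are homogeneous coordinates: a nonzero vector is a real multiple of the
standard vector with its slope. *)
Lemma direction_slope z : z != 0 ->
  exists2 t : R, t != 0 & z = t%:C * direction (slope z).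
Proof.
case: z => x y; rewrite eq_complex /= /slope /=.
have [->|y0] := eqVneq y 0.
  rewrite andbT => x0; exists x => //=.
  by apply/eqP; rewrite eq_complex /=; apply/andP; split; apply/eqP; ring.
move=> _; exists y => //=.
by apply/eqP; rewrite eq_complex /=; apply/andP; split; apply/eqP; field.
Qed.

Lemma linact_neq0 A z : \det A = 1 -> z != 0 -> linact A z != 0.
Proof.
move=> dA; apply: contra_neq => Az0.
have uA : A \in unitmx by rewrite unitmxE dA unitr1.
rewrite -[z]linact1 -(mulVmx uA) linactM Az0.
by rewrite -[0 in LHS](mulr0 0%:C) linactZ mul0r.
Qed.

Lemma slope_linact A z : z != 0 -> slope (linact A z) = mobius A (slope z).
Proof.
move=> /direction_slope[t t0 zE].
by rewrite {1}zE linactZ slopeZ.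
Qed.

Lemma mobiusM A B k : \det B = 1 -> mobius (A *m B) k = mobius A (mobius B k).
Proof.
move=> dB; rewrite {1}/mobius linactM slope_linact//.
by rewrite linact_neq0// direction_neq0.
Qed.

Lemma mobius1 k : mobius 1%:M k = k.
Proof. by rewrite /mobius linact1 slope_direction. Qed.

Lemma mobiusK A : \det A = 1 -> cancel (mobius A) (mobius (invmx A)).
Proof.
move=> dA k; rewrite -mobiusM// mulVmx ?mobius1//.
by rewrite unitmxE dA unitr1.
Qed.

Lemma image_mobiusM A B (Delta : set (boundary R)) : \det B = 1 ->
  mobius (A *m B) @` Delta = mobius A @` (mobius B @` Delta).
Proof.
move=> dB; rewrite image_comp; apply/eq_imagel => k _.
exact: mobiusM.
Qed.

Lemma image_mobiusK A (Delta : set (boundary R)) : \det A = 1 ->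
  mobius (invmx A) @` (mobius A @` Delta) = Delta.
Proof.
move=> dA; rewrite image_comp; apply/seteqP; split=> [_ [k Dk <-]|k Dk] /=.
  by rewrite mobiusK.
by exists k => //=; rewrite mobiusK.
Qed.

Lemma ideal_triangle_mobius A (Delta : set (boundary R)) :
  \det A = 1 -> ideal_triangle Delta -> ideal_triangle (mobius A @` Delta).
Proof.
move=> dA [p [q [r [pq qr pr ->]]]].
have inj := can_inj (mobiusK dA).
exists (mobius A p), (mobius A q), (mobius A r).
split; rewrite ?(inj_eq inj)//.
by rewrite !image_setU !image_set1.
Qed.

End Mobius.

(** * Transport of embedded triangles *)

(** Continuity on a subset without the subspace topology, as it is needed when the
domain itself is moved by a linear map. *)
Lemma within_continuousP (X Y : topologicalType) (D : set X) (f : X -> Y) :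
  {within D, continuous f} <->
  forall x, D x -> forall V, nbhs (f x) V -> nbhs x [set y | D y -> V (f y)].
Proof.
split=> [fc x Dx V nV|fc].
  have /= := fc x V nV.
  by rewrite -[nbhs _ _]/(nbhs_subspace (x : subspace D) _) -nbhs_subspace_in.
rewrite continuous_subspace_in => x; rewrite inE => Dx V nV.
rewrite /= -[nbhs _ _]/(nbhs_subspace (x : subspace D) _) -nbhs_subspace_in//.
by exact: fc.
Qed.

Section Triangles.
Context {R : realType} {M : ptopologicalType}.
Implicit Types (S : half_translation R M) (Sigma : set M) (A : 'M[R]_2).
Implicit Types (v : 'I_3 -> cplx R).

(** Two equal vertices would make the two edge vectors at [v 0] proportional. *)
Lemma nondegenerate_neq v i j : nondegenerate v -> i != j -> v j - v i != 0.
Proof.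
move=> nd ij; apply: contraNneq nd => /eqP; rewrite subr_eq0 => /eqP vij.
have I3 (l : 'I_3) : l = 0 \/ l = 1 \/ l = 2%:R.
  by case: l => [[|[|[|//]]] l3]; [left|right; left|right; right]; apply/val_inj.
rewrite !ReD !ImD !ReN !ImN; apply/eqP.
by move: vij ij; case: (I3 i) => [->|[->|->]]; case: (I3 j) => [->|[->|->]];
  rewrite ?eqxx// => <- _; ring.
Qed.

Lemma det_mx22 A : \det A = A 0 0 * A 1 1 - A 0 1 * A 1 0.
Proof.
rewrite (expand_det_row _ 0) !big_ord_recl big_ord0 /cofactor !det_mx11 !mxE /=.
have -> : lift ord0 ord0 = 1 :> 'I_2 by apply/val_inj.
have -> : lift 1 0 = 0 :> 'I_2 by apply/val_inj.
rewrite /= /bump /=; ring.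
Qed.

(** A matrix multiplies the signed area of a triangle by its determinant. *)
Lemma linact_nondegenerate A v : \det A = 1 ->
  nondegenerate v -> nondegenerate (linact A \o v).
Proof.
move=> dA; rewrite /nondegenerate.
have lin i : (linact A \o v) i - (linact A \o v) 0 = linact A (v i - v 0).
  by rewrite linactD linactN.
rewrite !lin.
set a := v 1 - v 0; set b := v 2%:R - v 0.
rewrite -subr_eq0 => ab; rewrite -subr_eq0.
suff -> : complex.Re (linact A a) * complex.Im (linact A b) -
    complex.Im (linact A a) * complex.Re (linact A b) =
    \det A * (complex.Re a * complex.Im b - complex.Im a * complex.Re b).
  by rewrite dA mul1r.
by rewrite det_mx22 /linact /=; ring.
Qed.

Lemma linact_triangle A v z : triangle v z ->
  triangle (linact A \o v) (linact A z).
Proof.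
move=> [t [t0 t1 ->]]; exists t; split=> //.
rewrite (big_morph (linact A) (linactD A) (_ : _ = 0)); last first.
  by rewrite -[0 in LHS](mulr0 0%:C) linactZ mul0r.
by apply: eq_bigr => i _; rewrite linactZ.
Qed.

Lemma side_slopes_linact A v : nondegenerate v ->
  side_slopes (linact A \o v) = mobius A @` side_slopes v.
Proof.
move=> nd; apply/seteqP; split=> [k [i [j [ij ->]]]|_ [k [i [j [ij ->]]] <-]].
  exists (slope (v j - v i)); first by exists i, j.
  by rewrite -slope_linact ?nondegenerate_neq// linactD linactN.
exists i, j; split => //.
by rewrite -slope_linact ?nondegenerate_neq// linactD linactN.
Qed.

(** The triangle is moved by [A] in the plane while its image is moved by [f]; in
flat charts the two cancel, so that the new parametrization is again a
translation. *)
Lemma embedded_triangle_linact S S' Sigma A (f : M -> M) v phi :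
  \det A = 1 -> homeomorphism f -> f @` Sigma = Sigma ->
  affine S S' Sigma A f -> embedded_triangle S Sigma v phi ->
  embedded_triangle S' Sigma (linact A \o v) (f \o phi \o linact (invmx A)).
Proof.
move=> dA hf fS fA [nd [cphi phiv] [iphi phiS] ophi chphi].
have uA : A \in unitmx by rewrite unitmxE dA unitr1.
have AK : cancel (linact A) (linact (invmx A)).
  by move=> z; rewrite -linactM mulVmx// linact1.
have AVK : cancel (linact (invmx A)) (linact A).
  by move=> z; rewrite -linactM mulmxV// linact1.
have TA z : triangle (linact A \o v) z -> triangle v (linact (invmx A) z).
  move=> /(linact_triangle (invmx A)).
  by congr triangle; apply/funext => i /=; rewrite AK.
have T'A z : (triangle (linact A \o v) `\` range (linact A \o v)) z ->
    (triangle v `\` range v) (linact (invmx A) z).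
  move=> [/TA Tz rz]; split=> // -[i _ viz]; apply: rz; exists i => //=.
  by rewrite viz AVK.
have [g [fK gK fc gc]] := hf.
split.
- exact: linact_nondegenerate.
- split; last first.
    by move=> i /=; rewrite AK -fS; exists (phi (v i)).
  apply/within_continuousP => x /TA Tx V nV.
  have nphi := (within_continuousP _ _).1 cphi _ Tx _ (fc _ _ nV).
  have := @linact_continuous _ (invmx A) x _ nphi.
  by apply: (@nbhsS _ x) => y /= + /TA; apply.
- split.
    move=> x y; rewrite !inE => /T'A Tx /T'A Ty /= /(can_inj fK) E.
    by apply: (can_inj AVK); apply: iphi E; rewrite inE.
  move=> _ [z /T'A Tz <-] /=; apply: (unmarked_image hf fS).
  by apply: phiS; exists (linact (invmx A) z).
- move=> x U /T'A Tx Ux.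
  have /= := ophi _ (linact A @^-1` U) Tx.
  case.
    by apply: (@linact_continuous _ A); rewrite AVK.
  move=> V nV VU; exists (g @^-1` V).
    by apply: gc; rewrite /= fK.
  move=> y /T'A Ty /=; rewrite fK => /(VU _ Ty) /=.
  by rewrite AVK.
- move=> x /T'A Tx.
  have [c [b [fc0 dc E]]] := chphi _ Tx.
  have np : ~ Sigma (phi (linact (invmx A) x)).
    by apply: phiS; exists (linact (invmx A) x).
  have [c' [b' [f' d' E']]] := affine_in_chart fA np fc0 dc.
  exists c', (linact A b + b'); split => //.
  have nphi := (within_continuousP _ _).1 cphi _ Tx.1 _ E'.
  have := @linact_continuous _ (invmx A) x _ (nbhsI nphi E).
  apply: (@nbhsS _ x) => y /= [near1 near2] /TA Ty.
  have [_ d'y ->] := near1 Ty; have [_ ->] := near2 Ty.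
  by split=> //; rewrite linactD AVK addrA.
Qed.

Lemma triangles_mobius S S' Sigma A (Delta : set (boundary R)) :
  affinely_equivalent S S' Sigma A -> triangles S Sigma Delta ->
  triangles S' Sigma (mobius A @` Delta).
Proof.
move=> [dA [f [hf fS fA]]] [ideal [v [phi [emb DE]]]].
split; first exact: ideal_triangle_mobius.
exists (linact A \o v), (f \o phi \o linact (invmx A)).
split; first exact: (embedded_triangle_linact dA hf fS fA emb).
by case: emb => nd _ _ _ _; rewrite DE side_slopes_linact.
Qed.

Lemma cusps_mobius S S' Sigma A (k : boundary R) :
  affinely_equivalent S S' Sigma A -> cusps S Sigma k ->
  cusps S' Sigma (mobius A k).
Proof.
move=> AS [Delta TD Dk]; exists (mobius A @` Delta); last by exists k.
exact: triangles_mobius AS TD.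
Qed.

End Triangles.

(** * Reference domains *)

Section Strip.
Context {R : realType}.
Implicit Types (a t : R) (Delta : set (boundary R)).

Lemma mobius_unipotent t (k : boundary R) :
  mobius (unipotent t) k = if k is Some x then Some (x + t) else None.
Proof.
rewrite /mobius /linact /slope !mxE /=; case: k => [x|] /=.
  by rewrite mul0r add0r mul1r oner_eq0 divr1 mul1r mulr1.
by rewrite mul0r mulr0 addr0 eqxx.
Qed.

Lemma ideal_triangle_cusp Delta : ideal_triangle Delta -> Delta None ->
  exists p q : R, p < q /\ Delta = [set None; Some p; Some q].
Proof.
suff wlog_q (q r : boundary R) : None != q -> q != r -> None != r ->
    exists x y : R, x < y /\ [set None; q; r] = [set None; Some x; Some y].
  move=> [p [q [r [pq qr pr ->]]]] [[]|] /= kE; rewrite -kE in pq qr pr *.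
  - exact: wlog_q.
  - by rewrite [[set p] `|` _]setUC; apply: wlog_q; rewrite // eq_sym.
  - by rewrite setUC setUA; apply: wlog_q; rewrite // eq_sym.
case: q r => [x|] [y|] // _ xy _; have {}xy : x != y by apply: contraNneq xy => ->.
move: xy; rewrite neq_lt => /orP[xy|yx]; [exists x, y|exists y, x]; split=> //.
by rewrite -!setUA [[set Some x] `|` _]setUC.
Qed.

(** A triangle with a vertex at infinity lies over the interval between its two other
vertices, above the half-circle joining them, all of whose points have height at most
[q - p]. *)
Lemma ideal_region_cusp (p q u v : R) : p < u < q -> q - p < v ->
  ideal_region [set None; Some p; Some q] (u +i* v).
Proof.
move=> /andP[pu uq] v0; split=> /=.
  by rewrite -[upper_half_plane _]/(is_true (0 < v)); lra.
have v2 : 0 <= (u - p) * (u - q) + v ^+ 2 by nra.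
move=> k1 k2 k3 [[]|] -> [[]|] -> [[]|] -> //; rewrite ?eqxx//= => _ _ _;
  rewrite /geodesic_form /geodesic_form_bd /=; nra.
Qed.

(** Choose the multiple of [a] that brings the left end of the interval below the
triangle into [[0, a)]; the interval then meets the open strip. *)
Lemma translate_meets_strip a Delta : 0 < a -> ideal_triangle Delta ->
  Delta None -> exists n : int,
    ideal_region (mobius (unipotent (n%:~R * a)) @` Delta) `&`
      [set z | 0 < complex.Re z < a] !=set0.
Proof.
move=> a0 ideal D0; have [p [q [pq ->]]] := ideal_triangle_cusp ideal D0.
pose n := - Num.floor (p / a); exists n.
rewrite !image_setU !image_set1 !mobius_unipotent.
set p' := p + n%:~R * a; set q' := q + n%:~R * a.
have /andP[p'0 p'a] : 0 <= p' < a.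
  have := Num.Theory.floor_itv (p / a).
  rewrite ler_pdivlMr// ltr_pdivrMr// intrD mulrDl mul1r => /andP[fl fu].
  by rewrite /p' /n mulrNz mulNr; apply/andP; split; lra.
have p'q' : p' < q' by rewrite /p' /q' ltrD2r.
pose m := Num.min q' a.
have pm : p' < m by rewrite lt_min p'q'.
have mq : m <= q' by rewrite ge_min lexx.
have ma : m <= a by rewrite ge_min lexx orbT.
(* Midpoint of the part of the interval over the strip; any height above [q' - p']
   will do. *)
exists (((p' + m) / 2) +i* (q' - p' + 1)); split => /=.
  apply: ideal_region_cusp; last lra.
  by apply/andP; split; lra.
by apply/andP; split; lra.
Qed.

End Strip.

Section ReferenceDomain.
Context {R : realType} {M : ptopologicalType}.
Context {S : half_translation R M} {Sigma : set M}.
Implicit Types (k : boundary R) (Delta : set (boundary R)).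

Lemma reference_domain_triangles k D Delta :
  reference_domain S Sigma k D -> D Delta ->
  triangles S Sigma Delta /\ Delta k.
Proof.
move=> [A [S' [a [[dA Ak] [im _] a0 _ ->]]]] [Delta' [TD D0 _] <-].
have AS := affinely_equivalent_image dA im.
split; first exact: triangles_mobius (affinely_equivalent_inv AS) TD.
by exists None; rewrite // -Ak mobiusK.
Qed.

(** After moving [k] to infinity, a translation of the stabilizer of infinity puts the
triangle over the strip; [B] is the conjugate of that translation. *)
Lemma reference_domain_covers k D Delta :
  reference_domain S Sigma k D -> triangles S Sigma Delta -> Delta k ->
  exists2 B, veech_group S Sigma B &
    mobius B k = k /\ D (mobius B @` Delta).
Proof.
move=> [A [S' [a [[dA Ak] [im _] a0 stab ->]]]] TD Dk.
have AS := affinely_equivalent_image dA im.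
have TD' := triangles_mobius AS TD.
have D0 : (mobius A @` Delta) None by exists k.
have [n meet] := translate_meets_strip a0 TD'.1 D0.
set U := unipotent (n%:~R * a) in meet.
have [US Uoo] : veech_group S' Sigma U /\ mobius U None = None.
  by have : [set B | veech_group S' Sigma B /\ mobius B None = None] U;
    [rewrite stab; exists n; left|].
have US' : affinely_equivalent S' S' Sigma U := US.
have dU : \det U = 1 := US'.1.
have UAS := affinely_equivalent_comp AS US'.
exists (invmx A *m (U *m A)).
  exact: affinely_equivalent_comp UAS (affinely_equivalent_inv AS).
have dUA : \det (U *m A) = 1 := UAS.1.
split; first by rewrite !mobiusM// Ak Uoo -Ak mobiusK.
exists (mobius U @` (mobius A @` Delta)); last by rewrite !image_mobiusM.
split=> //; first exact: triangles_mobius US' TD'.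
by exists None.
Qed.

End ReferenceDomain.

(** * The quotient graph and the algorithm *)

Section QuotientGraph.
Context {R : realType} {M : ptopologicalType}.
Context {S : half_translation R M} {Sigma : set M}.
Implicit Types (k : boundary R) (Delta : set (boundary R)) (x y z : node R).

Local Notation G := (veech_group S Sigma).
Local Notation eqv := (equivalent S Sigma).
Local Notation tri := (triangles S Sigma).
Local Notation vinf := (node_orbit S Sigma (inl None)).

(** A lattice is only given as a set of matrices with a fundamental domain; the
representative of the point [i] provides an element, from which the identity is
obtained as a quotient. *)
Lemma lattice_nonempty : lattice G -> G !=set0.
Proof.
move=> [_ [F [_ _ uniqF _]]].
have [|p [[_ [A GA _]] _]] := uniqF (0 +i* 1); last by exists A.
exact: ltr01.
Qed.

Lemma veech_det A : G A -> \det A = 1. Proof. by case. Qed.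

Lemma veechM A B : G A -> G B -> G (B *m A).
Proof. exact: affinely_equivalent_comp. Qed.

Lemma veechV A : G A -> G (invmx A).
Proof. exact: affinely_equivalent_inv. Qed.

Context (G_nonempty : G !=set0).

Lemma veech1 : G 1%:M.
Proof.
have [A GA] := G_nonempty.
rewrite -(mulVmx (_ : A \in unitmx)); first exact: veechM GA (veechV GA).
by rewrite unitmxE veech_det// unitr1.
Qed.

Lemma equivalent_refl k : eqv k k.
Proof. by exists 1%:M; [exact: veech1|rewrite mobius1]. Qed.

Lemma equivalent_sym k k' : eqv k k' -> eqv k' k.
Proof.
move=> [A GA ->]; exists (invmx A); first exact: veechV.
by rewrite mobiusK// veech_det.
Qed.

Lemma equivalent_trans k k' k'' : eqv k k' -> eqv k' k'' -> eqv k k''.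
Proof.
move=> [A GA ->] [B GB ->]; exists (B *m A); first exact: veechM.
by rewrite mobiusM// veech_det.
Qed.

Lemma node_actM A B x : G B -> node_act (A *m B) x = node_act A (node_act B x).
Proof.
move=> /veech_det dB; case: x => [k|Delta] /=; first by rewrite mobiusM.
by rewrite image_mobiusM.
Qed.

Lemma node_actK A x : G A -> node_act (invmx A) (node_act A x) = x.
Proof.
move=> /veech_det dA; case: x => [k|Delta] /=; first by rewrite mobiusK.
by rewrite image_mobiusK.
Qed.

Lemma node_orbit_refl x : node_orbit S Sigma x x.
Proof.
exists 1%:M; first exact: veech1.
case: x => [k|Delta] /=; first by rewrite mobius1.
congr (inr _); rewrite -[RHS]image_id.
by apply/eq_imagel => k _; exact: mobius1.
Qed.

(** An orbit is a homogeneous space: this replaces representatives by arbitrary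
elements when a walk in the quotient is followed. *)
Lemma node_orbit_transitive x y z : node_orbit S Sigma x y ->
  node_orbit S Sigma x z -> exists2 A, G A & z = node_act A y.
Proof.
move=> [A GA <-] [B GB <-]; exists (B *m invmx A).
  exact: veechM (veechV GA) GB.
by rewrite node_actM ?node_actK//; exact: veechV.
Qed.

Lemma node_orbit_equivalent k k' : eqv k k' ->
  node_orbit S Sigma (inl k) = node_orbit S Sigma (inl k').
Proof.
suff sub k1 k2 : eqv k1 k2 ->
    node_orbit S Sigma (inl k2) `<=` node_orbit S Sigma (inl k1).
  by move=> kk'; apply/seteqP; split; apply: sub => //; exact: equivalent_sym.
move=> [A GA ->] _ [B GB <-]; exists (B *m A); first exact: veechM.
by rewrite node_actM.
Qed.

Lemma quotient_node_cusp k :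
  quotient_nodes S Sigma (node_orbit S Sigma (inl k)) -> cusps S Sigma k.
Proof.
move=> [x nx xE].
have : node_orbit S Sigma x (inl k) by rewrite xE; exact: node_orbit_refl.
move=> [A GA]; case: x nx xE => // k0 /= ck0 _ [<-].
exact: cusps_mobius GA ck0.
Qed.

(** The cusps whose orbit is reached from that of infinity through at most [n]
triangles.  Each step may change the representative within its orbit, as in the
quotient graph. *)
Fixpoint cusp_ball (n : nat) : set (boundary R) :=
  if n is m.+1 then
    [set k | exists k' k'' Delta,
      [/\ cusp_ball m k', tri Delta, Delta k', Delta k'' & eqv k'' k]]
  else [set k | eqv None k].

Lemma cusp_ball_equivalent n k k' : cusp_ball n k -> eqv k k' -> cusp_ball n k'.
Proof.
case: n => [|n] /=; first exact: equivalent_trans.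
move=> [k1 [k2 [Delta [bk1 TD D1 D2 k2k]]]] kk'.
by exists k1, k2, Delta; split => //; exact: equivalent_trans k2k kk'.
Qed.

Context (cusp_infinity : cusps S Sigma None).

Lemma cusp_ball_cusps n : cusp_ball n `<=` cusps S Sigma.
Proof.
case: n => [k [A GA ->]|n k [k1 [k2 [Delta [_ TD _ D2 [A GA ->]]]]]].
  exact: cusps_mobius GA cusp_infinity.
by apply: cusps_mobius GA _; exists Delta.
Qed.

Lemma cusp_ballS n : cusp_ball n `<=` cusp_ball n.+1.
Proof.
move=> k bk; have [Delta TD Dk] := cusp_ball_cusps bk.
by exists k, k, Delta; split => //; exact: equivalent_refl.
Qed.

Lemma cusp_ball_le m n : (m <= n)%N -> cusp_ball m `<=` cusp_ball n.
Proof.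
elim: n => [|n IHn]; first by rewrite leqn0 => /eqP ->.
rewrite leq_eqVlt => /predU1P[->//|/IHn mn k /mn]; exact: cusp_ballS.
Qed.

(** A breadth-first search that does not grow once does not grow any more. *)
Lemma cusp_ball_stationary m n :
  cusp_ball m.+1 `<=` cusp_ball m -> cusp_ball n `<=` cusp_ball m.
Proof.
move=> stat; elim: n => [|n IHn]; first exact: cusp_ball_le.
move=> k [k1 [k2 [Delta [/IHn bk1 TD D1 D2 k2k]]]].
by apply: stat; exists k1, k2, Delta.
Qed.

Lemma walk_rcons (O P Q : set (node R)) n :
  walk S Sigma O P n -> quotient_nodes S Sigma Q ->
  quotient_adjacent S Sigma P Q -> walk S Sigma O Q n.+1.
Proof.
move=> [w [w0 wn wV wE]] QV PQ.
exists (fun i => if (i <= n)%N then w i else Q); split => //=.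
- by rewrite ltnn.
- by move=> i _; case: ifP => // ?; exact: wV.
- move=> i; rewrite ltnS => iln; rewrite iln.
  case: ltnP => [|nli]; first exact: wE.
  by have -> : i = n; [apply/eqP; rewrite eqn_leq iln|rewrite wn].
Qed.

Lemma cusp_ball_walk n k : cusp_ball n k ->
  walk S Sigma vinf (node_orbit S Sigma (inl k)) n.*2.
Proof.
elim: n k => [k /= nk|n IHn k].
  exists (fun=> vinf); split => //; first exact: node_orbit_equivalent.
  by move=> *; exists (inl None).
move=> [k1 [k2 [Delta [bk1 TD D1 D2 k2k]]]]; rewrite doubleS.
rewrite -(node_orbit_equivalent k2k).
apply: (walk_rcons (walk_rcons (IHn _ bk1) _ _)).
- by exists (inr Delta).
- exists (inl k1), (inr Delta); split => //; try exact: node_orbit_refl.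
  by exists Delta.
- by exists (inl k2) => //; exists Delta.
- exists (inr Delta), (inl k2); split => //; try exact: node_orbit_refl.
  by exists Delta.
Qed.

(** The graph is bipartite: a walk from a cusp visits cusps at even times and
triangles at odd times, so that two steps go through one triangle. *)
Lemma walk_cusp_ball P n : walk S Sigma vinf P n -> forall k, P (inl k) ->
  exists2 m, n = m.*2 & cusp_ball m k.
Proof.
move=> [w [w0 wn wV wE]].
suff inv i : (i <= n)%N ->
    (forall k, w i (inl k) -> exists2 m, i = m.*2 & cusp_ball m k) /\
    (forall Delta, w i (inr Delta) -> tri Delta /\
       exists m k, [/\ i = m.*2.+1, cusp_ball m k & Delta k]).
  by move=> k; rewrite -wn; exact: (inv n (leqnn n)).1.
elim: i => [_|i IHi ilt].
  rewrite w0; split=> [k [A GA [<-]]|Delta [A GA]//].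
  by exists 0%N => //; exists A.
have [IHc IHt] := IHi (ltnW ilt).
have [x [y [wx wy nx ny adj]]] := wE i ilt.
have orbit z : w i.+1 z -> exists2 A, G A & z = node_act A y.
  have [z0 _ z0E] := wV _ ilt; rewrite -z0E in wy *.
  exact: node_orbit_transitive.
case: x y adj wx wy nx ny orbit => [k|Delta] [k'|Delta'] //= adj wx wy nx ny orbit.
  have [m iE bk] := IHc _ wx.
  split=> [k' /orbit[A GA]//|Delta /orbit[A GA [->]]].
  split; first exact: triangles_mobius GA ny.
  exists m, (mobius A k); split; [by rewrite iE| |by exists k].
  by apply: cusp_ball_equivalent bk _; exists A.
have [TD [m [k [iE bk Dk]]]] := IHt _ wx.
split=> [k'' /orbit[A GA [->]]|? /orbit[]//].
exists m.+1; first by rewrite iE.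
by exists k, k', Delta; split => //; exists A.
Qed.

Lemma cusp_ball_dist n k : cusp_ball n k ->
  (quotient_dist S Sigma vinf (node_orbit S Sigma (inl k)) <= n%:R%:E)%E.
Proof.
move=> /cusp_ball_walk wk; apply: ereal_inf_lbound; exists n.*2 => //.
by rewrite -muln2 natrM mulfK// pnatr_eq0.
Qed.

Lemma dist_cusp_ball (e : \bar R) k :
  (quotient_dist S Sigma vinf (node_orbit S Sigma (inl k)) < e)%E ->
  exists2 n, cusp_ball n k & (n%:R%:E < e)%E.
Proof.
move=> /ereal_inf_lt[_ [n wn <-]].
have [m -> bm] := walk_cusp_ball wn (node_orbit_refl (inl k)).
by rewrite -muln2 natrM mulfK ?pnatr_eq0// => me; exists m.
Qed.

(** Distances are infima of half-lengths of walks between cusps, hence of natural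
numbers; the maximal one is the first radius of a ball containing a farthest
cusp, and the ball of that radius contains every cusp. *)
Lemma max_dist_cusp_ball d : is_max_dist S Sigma d ->
  exists n : nat, [/\ d = n%:R, cusps S Sigma `<=` cusp_ball n &
    exists2 k, cusp_ball n k & forall m, (m < n)%N -> ~ cusp_ball m k].
Proof.
move=> [[_ [k ck <-] distk] dmax].
have [n0 bn0 _] : exists2 n : nat, cusp_ball n k & (n%:R%:E < +oo :> \bar R)%E.
  by apply: (@dist_cusp_ball +oo%E); rewrite distk ltry.
have exn : exists n, `[< cusp_ball n k >] by exists n0; apply/asboolP.
case: (ex_minnP exn) => n /asboolP bn nmin.
have far m : (m < n)%N -> ~ cusp_ball m k.
  by move=> mn bm; have := nmin m; rewrite leqNgt mn => /(_ (asboolT bm)).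
have dn : d = n%:R.
  apply/eqP; rewrite eq_le -!lee_fin -distk cusp_ball_dist//= leNgt.
  apply/negP => /dist_cusp_ball[m bm]; rewrite lte_fin ltr_nat => mn.
  exact: far bm.
exists n; split=> //; last by exists k.
move=> k' ck'.
have [|m bm] := @dist_cusp_ball (n.+1%:R)%:E k'.
  apply: le_lt_trans (dmax _ _) _; first by exists k'.
  by rewrite dn lte_fin ltr_nat.
by rewrite lte_fin ltr_nat ltnS => mn; exact: cusp_ball_le mn _ bm.
Qed.

Section Algorithm.
Context {Istar : boundary R -> set (set (boundary R))}.
Context (referenceI :
  forall k, cusps S Sigma k -> reference_domain S Sigma k (Istar k)).

Local Notation N := (neighbours S Sigma Istar).

Lemma neighbours_cusp_ball n k k' : cusp_ball n k -> N k k' ->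
  cusp_ball n.+1 k'.
Proof.
move=> bk [_ _ [Delta ID Dk']].
have [TD Dk] := reference_domain_triangles (referenceI (cusp_ball_cusps bk)) ID.
by exists k, k', Delta; split => //; exact: equivalent_refl.
Qed.

(** The triangle is first moved to have the vertex [c], then, by an element fixing
[c], into the reference domain of [c].  The vertex in question becomes a
neighbour of [c], unless it is [c] itself. *)
Lemma triangle_neighbours c k k' k'' Delta : tri Delta ->
  Delta k' -> Delta k'' -> eqv k' c -> eqv k'' k ->
  eqv k c \/ exists2 k0, N c k0 & eqv k k0.
Proof.
move=> TD Dk' Dk'' [A GA cE] k''k.
have TAD := triangles_mobius GA TD.
have ADc : (mobius A @` Delta) c by exists k'.
have cc : cusps S Sigma c by exists (mobius A @` Delta).
have [B GB [Bc IB]] := reference_domain_covers (referenceI cc) TAD ADc.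
set k0 := mobius B (mobius A k'').
have kk0 : eqv k k0.
  apply: equivalent_trans (equivalent_sym k''k) _.
  apply: (@equivalent_trans _ (mobius A k'')); [by exists A|by exists B].
have [k0c|k0c] := eqVneq k0 c; first by left; rewrite -k0c.
have Bk0 : (mobius B @` (mobius A @` Delta)) k0.
  by exists (mobius A k'') => //; exists k''.
right; exists k0 => //; split => //; last by exists (mobius B @` (mobius A @` Delta)).
by exists (mobius B @` (mobius A @` Delta)) => //; exact: triangles_mobius GB TAD.
Qed.

Context {C0 C1 : nat -> set (boundary R)}.
Context (run : algorithm_run S Sigma Istar C0 C1).

(** The breadth-first invariant: [C0 n] represents the ball of radius [n], and
[C1 n] represents the orbits at distance exactly [n.+1]. *)
Definition level_invariant n :=
  [/\ (forall k, C1 n k -> cusp_ball n.+1 k /\ ~ cusp_ball n k),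
      C0 n `<=` cusp_ball n,
      (forall k, cusp_ball n k -> exists2 c, C0 n c & eqv k c) &
      (forall k, cusp_ball n.+1 k -> exists2 c, (C0 n `|` C1 n) c & eqv k c)].

Lemma level_invariant0 : level_invariant 0.
Proof.
have [[C0E C1N C1inf Ncover _] _] := run.
split; rewrite ?C0E.
- move=> k C1k; split.
    exact: (@neighbours_cusp_ball 0 None k (equivalent_refl None) (C1N _ C1k)).
  by move=> /equivalent_sym; exact: C1inf.
- by move=> _ ->; exact: equivalent_refl.
- by move=> k /equivalent_sym; exists None.
move=> k [k1 [k2 [Delta [bk1 TD D1 D2 k2k]]]].
have [kinf|[k0 Nk0 kk0]] := triangle_neighbours TD D1 D2 (equivalent_sym bk1) k2k.
  by exists None => //; left.
have [k0inf|[k3 C1k3 k03]] := Ncover _ Nk0.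
  by exists None; [left|exact: equivalent_trans kk0 k0inf].
by exists k3; [right|exact: equivalent_trans kk0 k03].
Qed.

(** A cusp of the next ball shares a triangle with a cusp equivalent to some [c] found
so far.  If [c] is in [C0 n] nothing new is reached; if [c] is in [C1 n] then
[triangle_neighbours] yields a neighbour of [c], which the step has examined. *)
Lemma level_invariantS n : (forall m, (m <= n)%N -> C1 m !=set0) ->
  level_invariant n -> level_invariant n.+1.
Proof.
move=> C1n [C1b C0b C0cover C01cover].
have [C0E C1N C1new Ncover] := run.2 n C1n.
have C0b' : C0 n.+1 `<=` cusp_ball n.+1.
  by rewrite C0E => k [/C0b/cusp_ballS//|/C1b[]].
split=> //; rewrite ?C0E//.
- move=> k C1k; have [c C1c cN] := C1N _ C1k; split.
    by apply: neighbours_cusp_ball cN; have [] := C1b _ C1c.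
  by move=> /C01cover[c' c'C kc']; exact: C1new C1k c'C kc'.
- move=> k [k1 [k2 [Delta [/C01cover[c cC k1c] TD D1 D2 k2k]]]].
  case: cC => [C0c|C1c].
    have [|c' c'C kc'] := C01cover k; last by exists c' => //; left.
    exists k1, k2, Delta; split => //.
    by apply: cusp_ball_equivalent (equivalent_sym k1c); exact: C0b.
  have [kc|[k0 Nk0 kk0]] := triangle_neighbours TD D1 D2 k1c k2k.
    by exists c => //; left; right.
  have [|[c' c'C k0c']|[c' [[c'C k0c'] _]]] := Ncover k0; first by exists c.
    by exists c'; [left|exact: equivalent_trans kk0 k0c'].
  by exists c'; [right|exact: equivalent_trans kk0 k0c'].
Qed.

Lemma level_invariant_run n :
  (forall m, (m < n)%N -> C1 m !=set0) -> level_invariant n.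
Proof.
elim: n => [_|n IHn C1n]; first exact: level_invariant0.
by apply: level_invariantS => //; apply: IHn => m mn; apply: C1n; exact: ltnW.
Qed.

(** An empty layer before the radius [n] would make the balls stationary from
there on, so that [k] would lie in a ball of smaller radius; an element of the
layer [n] would lie outside the ball that contains every cusp. *)
Lemma algorithm_stops n : cusps S Sigma `<=` cusp_ball n ->
  (exists2 k, cusp_ball n k & forall m, (m < n)%N -> ~ cusp_ball m k) ->
  C1 n = set0 /\ forall m, (m < n)%N -> C1 m !=set0.
Proof.
move=> all_n [k bk far].
have nonempty m : (m < n)%N -> C1 m !=set0.
  elim/ltn_ind: m => m IHm mn.
  have [_ C0b _ C01cover] : level_invariant m.
    by apply: level_invariant_run => i im; apply: IHm => //; exact: ltn_trans mn.
  apply/set0P/negP => /eqP C1m; apply: (far m mn).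
  apply: cusp_ball_stationary bk => k' /C01cover[c].
  rewrite C1m setU0 => /C0b bc /equivalent_sym; exact: cusp_ball_equivalent.
split=> //; apply/seteqP; split=> // k' C1k'.
have [C1b _ _ _] := level_invariant_run nonempty.
have [bk' nbk'] := C1b _ C1k'.
by apply: nbk'; apply: all_n; exact: cusp_ball_cusps bk'.
Qed.

End Algorithm.
End QuotientGraph.

(** A finite distance is realized by a walk in the quotient, which starts at a vertex
of the graph: the orbit of infinity. *)
Lemma max_dist_cusp_infinity (R : realType) (M : ptopologicalType)
    (S : half_translation R M) (Sigma : set M) (d : R) :
  veech_group S Sigma !=set0 -> is_max_dist S Sigma d -> cusps S Sigma None.
Proof.
move=> G0 [[v _ dv] _].
have : (quotient_dist S Sigma (node_orbit S Sigma (inl None)) v < +oo)%E.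
  by rewrite dv ltry.
move=> /ereal_inf_lt[_ [n [w [w0 _ wV _]] _] _].
by apply: (quotient_node_cusp G0); rewrite -w0; exact: wV.
Qed.

Unset Implicit Arguments.
Set Strict Implicit.

Theorem propositionA8 (R : realType) (M : ptopologicalType)
  (S : half_translation R M) (Sigma : set M)
  (veechS : veech_surface S Sigma)
  (periodicS : horizontally_periodic S Sigma)
  (normalizedS : normalized S Sigma)
  (Istar : option R -> set (set (option R)))
  (referenceI : forall k, cusps S Sigma k -> reference_domain S Sigma k (Istar k))
  (C0 C1 : nat -> set (option R))
  (run : algorithm_run S Sigma Istar C0 C1)
  (d1 : R) (maxd1 : is_max_dist S Sigma d1) :
  exists n : nat,
    [/\ d1 = n%:R, C1 n = set0 &
        forall m : nat, (m < n)%N -> C1 m !=set0].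
Proof.
have G0 := lattice_nonempty veechS.2.
have cusp_inf := max_dist_cusp_infinity G0 maxd1.
have [n [-> all_n far]] := max_dist_cusp_ball G0 cusp_inf maxd1.
have [C1n nonempty] := algorithm_stops G0 cusp_inf referenceI run all_n far.
by exists n.
Qed.
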